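(* Fix $d\in\mathbb N$. Let $\Theta_L$ be the set of pairs $(K,\bar A)$ such that $K\in[d]$ and $\bar A\in[0,\infty)^{d\times K}$ has all row sums equal to $1$ and satisfies the pure variable assumption. Define $$\Phi_L:\Theta_L\to[0,1]^{d\times d},\qquad (K,\bar A)\mapsto\Big(\sum_{a\in[K]}\bar A_{ja}\wedge\bar A_{\ell a}\Big)_{j,\ell\in[d]}.$$ Then $\Phi_L$ is injective up to column permutations of $\bar A$: if $(K^{(1)},\bar A^{(1)}),(K^{(2)},\bar A^{(2)})\in\Theta_L$ satisfy $\Phi_L(K^{(1)},\bar A^{(1)})=\Phi_L(K^{(2)},\bar A^{(2)})$, then $K^{(1)}=K^{(2)}$ and $\bar A^{(1)}\sim\bar A^{(2)}$.
   Context: Notation: $[m]=\{1,\dots,m\}$ and $x\wedge y=\min(x,y)$. Pure variable assumption: a matrix $A\in[0,\infty)^{d\times K}$ satisfies it if for every $a\in[K]$ there is a $j\in[d]$ with $A_{ja}>0$ and $A_{jb}=0$ for all $b\neq a$. Two matrices $A^{(1)},A^{(2)}\in\mathbb R^{d\times K}$ are called equivalent, written $A^{(1)}\sim A^{(2)}$, if $A^{(1)}=A^{(2)}P$ for some $K\times K$ permutation matrix $P$. *)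

(* Defs.v *)
From mathcomp Require Import all_boot all_order all_algebra.
From mathcomp Require Import reals.

Set Implicit Arguments.
Unset Strict Implicit.
Unset Printing Implicit Defensive.

Import Order.TTheory GRing.Theory Num.Theory.
Local Open Scope ring_scope.

Definition pure_variable (R : realType) (d K : nat) (A : 'M[R]_(d, K)) : Prop :=
  forall a : 'I_K, exists j : 'I_d,
    0 < A j a /\ forall b : 'I_K, b != a -> A j b = 0.

Definition mx_equiv (R : realType) (d K : nat) (A B : 'M[R]_(d, K)) : Prop :=
  exists P : 'M[R]_K, is_perm_mx P /\ A = B *m P.

(* [Theta_L K A] : the pair (K, A) belongs to Theta_L. *)
Definition Theta_L (R : realType) (d K : nat) (A : 'M[R]_(d, K)) : Prop :=
  [/\ (1 <= K <= d)%N,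
      forall j a, 0 <= A j a,
      forall j, \sum_(a < K) A j a = 1
    & pure_variable A].
Arguments Theta_L {R d} K A.

Definition Phi_L (R : realType) (d K : nat) (A : 'M[R]_(d, K)) : 'M[R]_d :=
  \matrix_(j < d, l < d) \sum_(a < K) Num.min (A j a) (A l a).
Arguments Phi_L {R d} K A.

(* On Theta_L, Phi_L takes its values in [0,1]^(d x d). *)
Lemma Phi_L_itv (R : realType) (d K : nat) (A : 'M[R]_(d, K)) :
  Theta_L K A -> forall j l, 0 <= Phi_L K A j l <= 1.
Proof.
case=> _ A0 A1 _ j l; rewrite mxE; apply/andP; split.
  by apply: sumr_ge0 => a _; rewrite le_min !A0.
by rewrite -(A1 j); apply: ler_sum => a _; rewrite ge_min lexx.
Qed.

(* Main.v *)
Require Import Defs.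
From mathcomp Require Import all_boot all_order all_algebra.
From mathcomp Require Import fingroup perm reals.

Set Implicit Arguments.
Unset Strict Implicit.
Unset Printing Implicit Defensive.

Import Order.TTheory GRing.Theory Num.Theory.
Local Open Scope ring_scope.

(** Since rows sum to 1, a pure row [j] for [a] is the basis vector [e_a], so
    [Phi j l = A l a], and two rows have [Phi]-entry [0] iff their supports are
    disjoint.  Pure rows of [A1], one for each column, thus give [K1] rows of
    [A2] with pairwise disjoint nonempty supports, whence [K1 <= K2].  When
    [K1 = K2] these supports must be singletons, so the same rows are pure for
    [A2], and both matrices are read off from the corresponding rows of [Phi]. *)

Section ThetaL.
Variables (R : realType) (d K : nat) (A : 'M[R]_(d, K)).
Hypothesis hA : Theta_L K A.

Lemma Theta_L_entry_le1 j a : A j a <= 1.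
Proof.
case: hA => _ A0 A1 _; rewrite -(A1 j) (bigD1 a) //= lerDl.
by apply: sumr_ge0 => b _.
Qed.

Lemma Theta_L_row_pos j : exists a, 0 < A j a.
Proof.
case: hA => _ A0 A1 _; apply/existsP; apply: contraT => /existsPn Anpos.
have := A1 j; rewrite big1 => [/esym/eqP|a _]; first by rewrite oner_eq0.
by apply: le_anti; rewrite A0 andbT leNgt Anpos.
Qed.

(** Nonnegative minima sum to zero only when each one vanishes. *)
Lemma Phi_L_eq0P j l :
  reflect (forall a, 0 < A j a -> A l a = 0) (Phi_L K A j l == 0).
Proof.
case: hA => _ A0 _ _; rewrite mxE psumr_eq0; last first.
  by move=> a _; rewrite le_min !A0.
apply: (iffP allP) => [min0 a Aja | disj a _].
  have /= := min0 a (mem_index_enum a).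
  by case: leP => _ /eqP // Aja0; rewrite Aja0 ltxx in Aja.
have := A0 j a; rewrite le_eqVlt => /predU1P[<-|/[dup] Aja /disj ->] /=.
  by rewrite min_l.
by rewrite min_r // ltW.
Qed.

(** The row sum forces [A j a = 1]; as entries are at most 1, the one surviving minimum is
    [A l a]. *)
Lemma Phi_L_pure_row j a : (forall b, b != a -> A j b = 0) ->
  forall l, Phi_L K A j l = A l a.
Proof.
case: hA => _ A0 A1 _ Aj0 l.
have Aja : A j a = 1 by rewrite -(A1 j) (bigD1 a) //= big1 ?addr0.
rewrite mxE (bigD1 a) //= big1 => [|b /Aj0 ->]; last by rewrite min_l.
by rewrite addr0 Aja min_r // Theta_L_entry_le1.
Qed.

Lemma Theta_L_pure_rows :
  exists f : 'I_K -> 'I_d, forall a b, b != a -> A (f a) b = 0.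
Proof.
case: hA => _ _ _ pureA.
have /fin_all_exists[f fP] a : exists j, forall b, b != a -> A j b = 0.
  by have [j [_ Aj0]] := pureA a; exists j.
by exists f.
Qed.

End ThetaL.

Section Transfer.
Variables (R : realType) (d K1 K2 : nat).
Variables (A1 : 'M[R]_(d, K1)) (A2 : 'M[R]_(d, K2)).
Hypotheses (h1 : Theta_L K1 A1) (h2 : Theta_L K2 A2).
Hypothesis hPhi : Phi_L K1 A1 = Phi_L K2 A2.

Lemma pure_rows_transfer (f : 'I_K1 -> 'I_d) :
    (forall a b, b != a -> A1 (f a) b = 0) ->
  exists s : 'I_K1 -> 'I_K2, injective s /\
    forall a a', a' != a -> A2 (f a) (s a') = 0.
Proof.
move=> pure1; have /fin_all_exists[s sP] a := Theta_L_row_pos h2 (f a).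
have off a a' : a' != a -> A2 (f a) (s a') = 0.
  (* The common [Phi_L] entry at [f a'], [f a] is [A1 (f a) a' = 0], so these rows of [A2] have
     disjoint supports, and [s a'] lies in that of [f a']. *)
  move=> neq; apply: (Phi_L_eq0P h2 (f a') (f a) _) (sP a').
  by rewrite -hPhi (Phi_L_pure_row h1 (pure1 a')) pure1.
exists s; split=> // a a' eq_s; apply/eqP; apply: contraT => neq.
by have := sP a'; rewrite -eq_s off ?ltxx.
Qed.

Lemma Phi_L_leq_size : (K1 <= K2)%N.
Proof.
have [f /pure_rows_transfer[s [s_inj _]]] := Theta_L_pure_rows h1.
by rewrite -[K1]card_ord -[K2]card_ord (leq_card s s_inj).
Qed.

End Transfer.

Theorem proposition2p9 (R : realType) (d : nat)
    (K1 K2 : nat) (A1 : 'M[R]_(d, K1)) (A2 : 'M[R]_(d, K2))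
    (h1 : Theta_L K1 A1) (h2 : Theta_L K2 A2)
    (hPhi : Phi_L K1 A1 = Phi_L K2 A2) :
  exists eK : K1 = K2, mx_equiv (castmx (erefl d, eK) A1) A2.
Proof.
have eK : K1 = K2.
  apply/eqP; rewrite eqn_leq (Phi_L_leq_size h1 h2 hPhi).
  exact: Phi_L_leq_size h2 h1 (esym hPhi).
exists eK; case: K2 / eK A2 h2 hPhi => A2 h2 hPhi; rewrite castmx_id.
have [f pure1] := Theta_L_pure_rows h1.
have [s [s_inj off]] := pure_rows_transfer h1 h2 hPhi pure1.
(* With equal sizes the injection [s] is onto, so [off] reaches every column but [s a]. *)
have pure2 a b : b != s a -> A2 (f a) b = 0.
  have /codomP[a' ->] := inj_card_onto s_inj (leqnn _) b.
  by rewrite (inj_eq s_inj); apply: off.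
(* Column [a] of [A1] should be column [s a] of [A2]; right multiplication by the matrix of the
   inverse permutation does this reindexing. *)
exists (perm_mx (perm s_inj)^-1%g); split; first exact: perm_mx_is_perm.
rewrite -col_permE; apply/matrixP => l a; rewrite mxE permE.
by rewrite -(Phi_L_pure_row h1 (pure1 a)) hPhi (Phi_L_pure_row h2 (pure2 a)).
Qed.
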